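(* Let $\mathbb{F}$ be an arbitrary field (finite or infinite), $G$ a finite group, and let $\varepsilon:\mathbb{N}\to G$ define a $G$-grading on $\mathrm{UT}$. Then $\varepsilon$ is eventually incomplete if and only if $\mathrm{Id}_G(\mathrm{UT},\varepsilon)\ne0$.
   Context: $\mathbb{N}=\{1,2,\ldots\}$. $\mathrm{UT}$ is the associative $\mathbb{F}$-algebra with basis $\{e_{ij}\mid 1\le i\le j\}$ ($i,j\in\mathbb{N}$) and product $e_{ij}e_{k\ell}=\delta_{jk}e_{i\ell}$. A map $\varepsilon:\mathbb{N}\to G$ defines a $G$-grading on $\mathrm{UT}$ in which each $e_{ij}$ is homogeneous of degree $\varepsilon(i)\varepsilon(i+1)\cdots\varepsilon(j-1)$ (so $\deg_G e_{i,i+1}=\varepsilon(i)$ and $\deg_G e_{ii}=1$). For $i\in\mathbb{N}$ let $R_i=e_{ii}J(\mathrm{UT})=\mathrm{Span}\{e_{ij}\mid j>i\}$, and $\mathrm{Supp}\,R_i=\{\deg_G e_{ij}\mid j>i\}$. The grading $\varepsilon$ is eventually incomplete if there exists $N\in\mathbb{N}$ such that $\mathrm{Supp}\,R_i\ne G$ for all $i\ge N$. $\mathbb{F}\langle X^G\rangle$ is the free associative unital algebra on variables $x_i^{(g)}$ ($g\in G$, $i\in\mathbb{N}$), with $\deg_G x_i^{(g)}=g$. $\mathrm{Id}_G(\mathrm{UT},\varepsilon)$ is the set of all $f(x_1^{(g_1)},\ldots,x_m^{(g_m)})\in\mathbb{F}\langle X^G\rangle$ such that $f(a_1,\ldots,a_m)=0$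 for all $a_i$ in the homogeneous component of degree $g_i$ of $\mathrm{UT}$ with the grading defined by $\varepsilon$ (constant terms are evaluated in the unitization of $\mathrm{UT}$). *)

(* Defs.v *)
From HB Require Import structures.
From mathcomp Require Import all_boot all_order all_fingroup all_algebra.
From mathcomp Require Import finmap.
From mathcomp Require Import classical_sets.
From mathcomp Require Import monalg.

Set Implicit Arguments.
Unset Strict Implicit.
Unset Printing Implicit Defensive.

Import GRing.Theory.

Local Open Scope ring_scope.

Section FreeAlgebra.
Variable X : choiceType.

Definition word : Type := seq X.

HB.instance Definition _ := Choice.copy word (seq X).

Fact word_unit (v w : word) : v ++ w = [::] -> v = [::] /\ w = [::].
Proof. by case: v. Qed.

HB.instance Definition _ :=
  Choice_isMonomialDef.Build word (@catA X) (@cat0s X) (@cats0 X) word_unit.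

End FreeAlgebra.

(* The monoid algebra of the free monoid on [X]. *)
Notation "{ 'free' F [ X ] }" := {malg F[word X]}
  (at level 0, F, X at level 2, format "{ 'free'  F [ X ] }") : type_scope.

(* Rows and columns are numbered from 0: [nat] is the paper's {1, 2, ...}
   shifted by one. *)
Definition UTidx : choiceType := {p : nat * nat | (p.1 <= p.2)%N}.

Notation UT F := {malg F[UTidx]}.

Section UTalgebra.
Variable F : fieldType.
Implicit Types (u v w : UT F) (p q r : UTidx).

(* The basis vector e_ij when i <= j, and 0 otherwise. *)
Definition UTe (i j : nat) : UT F :=
  if insub (i, j) is Some p then << p >> else 0.

Definition UTmul u v : UT F :=
  \sum_(p <- msupp u) \sum_(q <- msupp v)
    (u@_p * v@_q) *: (UTe (val p).1 (val q).2 *+ ((val p).2 == (val q).1)).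

Lemma UTmulw (d1 d2 : {fset UTidx}) u v :
  (msupp u `<=` d1)%fset -> (msupp v `<=` d2)%fset ->
  UTmul u v = \sum_(p <- d1) \sum_(q <- d2)
    (u@_p * v@_q) *: (UTe (val p).1 (val q).2 *+ ((val p).2 == (val q).1)).
Proof.
move=> le1 le2; rewrite /UTmul (big_fset_incl _ le1) /=.
  apply/eq_bigr=> p _; apply/big_fset_incl => // q _ /mcoeff_outdom ->.
  by rewrite mulr0 scale0r.
by move=> p _ /mcoeff_outdom up; rewrite big1 // => q _; rewrite up mul0r scale0r.
Qed.

Lemma UTmulDl : left_distributive UTmul +%R.
Proof.
move=> u v w.
have sub := @fsubset_refl _ (msupp w).
rewrite (UTmulw (fsubsetUl (msupp u) (msupp v)) sub) (UTmulw (fsubsetUr (msupp u) (msupp v)) sub).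
rewrite (UTmulw (msuppD_le u v) sub) -big_split /=; apply/eq_bigr=> p _.
rewrite -big_split /=; apply/eq_bigr=> q _.
by rewrite -scalerDl -mulrDl -mcoeffD.
Qed.

Lemma UTmulDr : right_distributive UTmul +%R.
Proof.
move=> w u v.
have sub := @fsubset_refl _ (msupp w).
rewrite (UTmulw sub (fsubsetUl (msupp u) (msupp v))) (UTmulw sub (fsubsetUr (msupp u) (msupp v))).
rewrite (UTmulw sub (msuppD_le u v)) -big_split /=; apply/eq_bigr=> p _.
rewrite -big_split /=; apply/eq_bigr=> q _.
by rewrite -scalerDl -mulrDr -mcoeffD.
Qed.

Lemma UTmul0l : left_zero 0 UTmul.
Proof. by move=> u; rewrite /UTmul msupp0 big_seq_fset0. Qed.

Lemma UTmul0r : right_zero 0 UTmul.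
Proof. by move=> u; rewrite /UTmul big1 // => p _; rewrite msupp0 big_seq_fset0. Qed.

Lemma UTmulZl a u v : UTmul (a *: u) v = a *: UTmul u v.
Proof.
have sub := @fsubset_refl _ (msupp v).
rewrite (UTmulw (msuppZ_le a u) sub) /UTmul scaler_sumr; apply/eq_bigr=> p _.
rewrite scaler_sumr; apply/eq_bigr=> q _.
by rewrite mcoeffZ scalerA mulrA.
Qed.

Lemma UTmulZr a u v : UTmul u (a *: v) = a *: UTmul u v.
Proof.
have sub := @fsubset_refl _ (msupp u).
rewrite (UTmulw sub (msuppZ_le a v)) /UTmul scaler_sumr; apply/eq_bigr=> p _.
rewrite scaler_sumr; apply/eq_bigr=> q _.
by rewrite mcoeffZ scalerA mulrCA.
Qed.

Lemma UTe_idx p : UTe (val p).1 (val p).2 = << p >>.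
Proof. by rewrite /UTe -surjective_pairing valK. Qed.

Lemma UTe_eq0 i j : (j < i)%N -> UTe i j = 0.
Proof. by move=> ji; rewrite /UTe insubF //= leqNgt ji. Qed.

Lemma UTe_mul i j k l : (i <= j)%N -> (k <= l)%N ->
  UTmul (UTe i j) (UTe k l) = UTe i l *+ (j == k).
Proof.
move=> ij kl.
pose p : UTidx := Sub (i, j) ij; pose q : UTidx := Sub (k, l) kl.
have -> : UTe i j = << p >> by exact: (UTe_idx p).
have -> : UTe k l = << q >> by exact: (UTe_idx q).
rewrite (UTmulw msuppU_le msuppU_le) !big_seq_fset1 !mcoeffUU mul1r scale1r.
by [].
Qed.

Lemma UT_expand u : u = \sum_(p <- msupp u) u@_p *: UTe (val p).1 (val p).2.
Proof.
rewrite {1}[u]monalgE; apply/eq_bigr=> p _; rewrite UTe_idx.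
by apply/malgP=> q; rewrite mcoeffZ !mcoeffU mulrnAr mulr1.
Qed.

Lemma UT_ind (P : UT F -> Prop) :
    P 0 -> (forall u v, P u -> P v -> P (u + v)) ->
    (forall a u, P u -> P (a *: u)) ->
    (forall i j, (i <= j)%N -> P (UTe i j)) ->
  forall u, P u.
Proof.
move=> P0 PD PZ Pe u; rewrite [u]UT_expand; apply: (big_ind P) => // p _.
by apply: PZ; apply: Pe; apply: valP p.
Qed.

Lemma UTmulA : associative UTmul.
Proof.
move=> u v w; elim/UT_ind: u => [|u1 u2 IH1 IH2|a u IH|i j ij].
- by rewrite !UTmul0l.
- by rewrite !UTmulDl IH1 IH2.
- by rewrite !UTmulZl IH.
elim/UT_ind: v => [|v1 v2 IH1 IH2|a v IH|k l kl].
- by rewrite UTmul0l !UTmul0r UTmul0l.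
- by rewrite UTmulDl !UTmulDr UTmulDl IH1 IH2.
- by rewrite UTmulZl !UTmulZr UTmulZl IH.
elim/UT_ind: w => [|w1 w2 IH1 IH2|a w IH|m n mn].
- by rewrite !UTmul0r.
- by rewrite !UTmulDr IH1 IH2.
- by rewrite !UTmulZr IH.
rewrite !UTe_mul //; have [?|jk] := eqVneq j k; last first.
  rewrite mulr0n UTmul0l; have [?|_] := eqVneq l m; last by rewrite UTmul0r.
  by subst m; rewrite mulr1n UTe_mul ?(leq_trans kl mn) // (negPf jk).
subst k; rewrite mulr1n UTe_mul ?(leq_trans ij kl) //.
have [?|_] := eqVneq l m; last by rewrite UTmul0r.
by subst m; rewrite mulr1n UTe_mul ?(leq_trans kl mn) // eqxx.
Qed.

End UTalgebra.

Section Unitization.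
Variable F : fieldType.

Definition unitization : Type := (F^o * UT F)%type.

HB.instance Definition _ := GRing.Lmodule.copy unitization (F^o * UT F)%type.

Implicit Types x y z : unitization.

Definition unitization_one : unitization := (1, 0).

Definition unitization_mul x y : unitization :=
  (x.1 * y.1, x.1 *: y.2 + y.1 *: x.2 + UTmul x.2 y.2).

Fact unitization_mulA : associative unitization_mul.
Proof.
move=> [a u] [b v] [c w]; rewrite /unitization_mul /=; congr (_, _).
  by rewrite mulrA.
rewrite !UTmulDr !UTmulDl !UTmulZr !UTmulZl UTmulA !scalerDr !scalerA.
rewrite (mulrC c a) (mulrC c b).
move: ((a * b) *: w) ((a * c) *: v) (a *: UTmul v w) ((b * c) *: u)
  (b *: UTmul u w) (c *: UTmul u v) (UTmul (UTmul u v) w) => x1 x2 x3 x4 x5 x6 x7.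
rewrite -!addrA; congr (_ + (_ + _)).
by rewrite addrCA; congr (_ + _); rewrite [RHS]addrCA; congr (_ + _); rewrite addrCA.
Qed.

Fact unitization_mul1l : left_id unitization_one unitization_mul.
Proof.
by case=> a u; rewrite /unitization_mul /= mul1r scale1r scaler0 addr0 UTmul0l addr0.
Qed.

Fact unitization_mul1r : right_id unitization_one unitization_mul.
Proof.
by case=> a u; rewrite /unitization_mul /= mulr1 scale1r scaler0 add0r UTmul0r addr0.
Qed.

Fact unitization_mulDl : left_distributive unitization_mul +%R.
Proof.
move=> [a u] [b v] [c w]; rewrite /unitization_mul /=; congr (_, _).
  by rewrite mulrDl.
rewrite UTmulDl scalerDl scalerDr.
move: (a *: w) (b *: w) (c *: u) (c *: v) (UTmul u w) (UTmul v w).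
by move=> x1 x2 x3 x4 x5 x6; rewrite (addrACA x1) [RHS]addrACA.
Qed.

Fact unitization_mulDr : right_distributive unitization_mul +%R.
Proof.
move=> [a u] [b v] [c w]; rewrite /unitization_mul /=; congr (_, _).
  by rewrite mulrDr.
rewrite UTmulDr scalerDl scalerDr.
move: (a *: v) (a *: w) (b *: u) (c *: u) (UTmul u v) (UTmul u w).
by move=> x1 x2 x3 x4 x5 x6; rewrite (addrACA x1) [RHS]addrACA.
Qed.

Fact unitization_one_neq0 : unitization_one != 0.
Proof. by rewrite xpair_eqE oner_eq0. Qed.

HB.instance Definition _ := GRing.Zmodule_isNzRing.Build unitization
  unitization_mulA unitization_mul1l unitization_mul1r
  unitization_mulDl unitization_mulDr unitization_one_neq0.

Fact unitization_scaleAl (a : F) x y : a *: (x * y) = (a *: x) * y.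
Proof.
case: x y => [b u] [c v]; congr (_, _); first by rewrite /= [_ *: _]mulrA.
by rewrite /= !scalerDr !scalerA UTmulZl [c * a]mulrC.
Qed.

HB.instance Definition _ :=
  GRing.Lmodule_isLalgebra.Build F unitization unitization_scaleAl.

Definition to_unitization (u : UT F) : unitization := (0, u).

End Unitization.

Section Grading.
Variables (F : fieldType) (G : finGroupType) (eps : nat -> G).

Definition UTdeg (i j : nat) : G := (\prod_(i <= k < j) eps k)%g.

Definition UTcomp (g : G) : set (UT F) :=
  [set u | {in msupp u, forall p, UTdeg (val p).1 (val p).2 = g}].

(* Supp R_i, where R_i = e_ii J(UT) = Span{e_ij | j > i}. *)
Definition SuppR (i : nat) : set G :=
  [set UTdeg i j | j in [set j | (i < j)%N]].

Definition eventually_incomplete : Prop :=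
  exists N : nat, forall i : nat, (N <= i)%N -> SuppR i <> [set: G]%classic.

(* The variable x_i^(g) is the pair [(g, i)]. *)
Definition eval_free (a : G * nat -> UT F) (f : {free F[(G * nat)%type]}) :
    unitization F :=
  mmap (fun c : F => c%:A)
       (fun w : word (G * nat)%type => \prod_(x <- w) to_unitization (a x)) f.

(* Variables absent from [f] are assigned too; this is harmless since 0 lies in
   every component. *)
Definition graded_identities : set {free F[(G * nat)%type]} :=
  [set f | forall a : G * nat -> UT F,
     (forall g i, UTcomp g (a (g, i))) -> eval_free a f = 0].

End Grading.

Arguments UTcomp F {G} eps g.
Arguments graded_identities F {G} eps.

(* Main.v *)
Require Import Defs.
From mathcomp Require Import all_boot all_order all_fingroup all_algebra.
From mathcomp Require Import classical_sets.
From mathcomp Require Import monalg.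
From mathcomp Require Import finmap boolp zify.

(** View e_ij as an edge from i to j labelled by its degree.  Evaluating a
word at homogeneous elements gives a matrix whose (i, l) entry is a sum over
the paths from i to l spelling the word.

If infinitely many rows have full support, then so do all rows, since
Supp R_i contains deg e_ik * Supp R_k ([SuppR_le]).  Every word w is then
spelled by a strictly increasing path t_0 < ... < t_m.  Sending each variable
to the sum of the e_(t_k, t_k+1) over the positions k at which it occurs in w
makes this path the only one from t_0 to t_m, so among all words w alone
has a nonzero entry at (t_0, t_m), and that entry is 1
([separating_assignment]).  An identity therefore has zero coefficient at
every word.  Coefficients are read off as matrix entries, so no linearization
is involved and the field may be finite.

If Supp R_i is a proper subset of G for all i >= N, some monomial is an
identity.  A variable of degree different from 1 has no diagonal part, so in a
word made of such variables all steps of a path increase strictly: N + 1 of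
them lead to a row beyond N ([word_value_path]).  Let these be followed by a
word whose nonempty prefixes have all elements of G as their degrees
([covering_word]).  A path spelling it from row k would give
Supp R_k = G, so there is none, and the monomial vanishes
([monomial_identity]). *)

Local Open Scope ring_scope.

Set Implicit Arguments.
Unset Strict Implicit.
Unset Printing Implicit Defensive.

Import GRing.Theory.

(** * Matrix entries *)

Section Entries.
Variable F : fieldType.
Implicit Types (u v : UT F) (y z : unitization F).

Definition UTcoef u (i j : nat) : F :=
  oapp (fun p : UTidx => u@_p) 0 (insub (i, j)).

Lemma UTcoef_val u (p : UTidx) : UTcoef u (val p).1 (val p).2 = u@_p.
Proof. by rewrite /UTcoef -surjective_pairing valK. Qed.

Lemma UTcoef_lt u i j : (j < i)%N -> UTcoef u i j = 0.
Proof. by move=> ji; rewrite /UTcoef insubF //= leqNgt ji. Qed.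

Lemma UTcoef0 i j : UTcoef 0 i j = 0.
Proof. by rewrite /UTcoef; case: insub => //= p; rewrite mcoeff0. Qed.

Lemma UTcoefD u v i j : UTcoef (u + v) i j = UTcoef u i j + UTcoef v i j.
Proof.
by rewrite /UTcoef; case: insub => [p|] /=; rewrite ?mcoeffD ?addr0.
Qed.

Lemma UTcoefZ a u i j : UTcoef (a *: u) i j = a * UTcoef u i j.
Proof.
by rewrite /UTcoef; case: insub => [p|] /=; rewrite ?mcoeffZ ?mulr0.
Qed.

Lemma UTcoefe a b i j : (a <= b)%N ->
  UTcoef (UTe F a b) i j = ((a == i) && (b == j))%:R.
Proof.
move=> ab; pose p : UTidx := Sub (a, b) ab.
have -> : UTe F a b = << p >> by exact: (UTe_idx F p).
rewrite /UTcoef; case: insubP => [q _ qE|] /=; last first.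
  rewrite -ltnNge => ji; case: andP => // -[/eqP ai /eqP bj]; lia.
by rewrite mcoeffU -val_eqE qE xpair_eqE.
Qed.

(** The finite range of summation is harmless, since column l vanishes below
row l. *)
Lemma UTcoefM u v i l :
  UTcoef (UTmul u v) i l = \sum_(k < l.+1) UTcoef u i k * UTcoef v k l.
Proof.
elim/UT_ind: u => [|u1 u2 IH1 IH2|a u IH|a b ab].
- by rewrite UTmul0l UTcoef0 big1 // => k _; rewrite UTcoef0 mul0r.
- rewrite UTmulDl UTcoefD IH1 IH2 -big_split /=; apply/eq_bigr=> k _.
  by rewrite UTcoefD mulrDl.
- rewrite UTmulZl UTcoefZ IH mulr_sumr; apply/eq_bigr=> k _.
  by rewrite UTcoefZ mulrA.
elim/UT_ind: v => [|v1 v2 IH1 IH2|c v IH|c d cd].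
- by rewrite UTmul0r UTcoef0 big1 // => k _; rewrite UTcoef0 mulr0.
- rewrite UTmulDr UTcoefD IH1 IH2 -big_split /=; apply/eq_bigr=> k _.
  by rewrite UTcoefD mulrDr.
- rewrite UTmulZr UTcoefZ IH mulr_sumr; apply/eq_bigr=> k _.
  by rewrite UTcoefZ mulrCA.
rewrite UTe_mul //.
under eq_bigr => k _ do rewrite !UTcoefe // -natrM mulnb.
have [bc|bc] := eqVneq b c; last first.
  rewrite mulr0n UTcoef0 big1 // => k _; case: andP => //.
  by case=> /andP[_ /eqP bk] /andP[/eqP ck _]; case/eqP: bc; rewrite bk ck.
subst c; rewrite mulr1n UTcoefe ?(leq_trans ab cd) //.
have [dl|dl] := eqVneq d l; last first.
  by rewrite andbF big1 // => k _; rewrite !andbF.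
have bl : (b < l.+1)%N by lia.
rewrite (bigD1 (Ordinal bl)) //= eqxx !andbT big1 ?addr0 // => k kb.
case: andP => // -[/andP[_ /eqP bk]] _; case/eqP: kb; exact/val_inj.
Qed.

(** The scalar component is put on the diagonal, so that the unitization acts
by upper triangular matrices and the empty word needs no separate treatment. *)
Definition entry z (i j : nat) : F := z.1 *+ (i == j) + UTcoef z.2 i j.

Lemma entry0 i j : entry 0 i j = 0.
Proof. by rewrite /entry UTcoef0 mul0rn addr0. Qed.

Lemma entryD y z i j : entry (y + z) i j = entry y i j + entry z i j.
Proof. by rewrite /entry UTcoefD mulrnDl addrACA. Qed.

Lemma entryZ a z i j : entry (a *: z) i j = a * entry z i j.
Proof. by rewrite /entry UTcoefZ mulrDr mulrnAr. Qed.

Lemma entry1 i j : entry 1 i j = (i == j)%:R.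
Proof. by rewrite /entry UTcoef0 addr0. Qed.

Lemma entry_to_unitizationM u z i l :
  entry (to_unitization u * z) i l
  = \sum_(k < l.+1) UTcoef u i k * entry z k l.
Proof.
have -> : to_unitization u * z
    = (0 * z.1, 0 *: z.2 + z.1 *: u + UTmul u z.2) by [].
rewrite /entry /= mul0r mul0rn add0r scale0r add0r UTcoefD UTcoefZ UTcoefM.
under [RHS]eq_bigr => k _ do rewrite mulrDr.
rewrite big_split /=; congr (_ + _).
rewrite big_ord_recr /= eqxx big1 ?add0r 1?mulrC // => k _.
by rewrite (ltn_eqF (ltn_ord k)) mulr0n mulr0.
Qed.

End Entries.

Section GradedEvaluation.
Variables (F : fieldType) (G : finGroupType) (eps : nat -> G).

Implicit Types (w v : word (G * nat)%type).
Implicit Types (a b : G * nat -> UT F) (x : G * nat).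

Definition word_value a w : unitization F :=
  \prod_(x <- w) to_unitization (a x).

Definition graded_assignment a : Prop := forall g i, UTcomp F eps g (a (g, i)).

Lemma entry_eval_free a (f : {free F[(G * nat)%type]}) i j :
  entry (eval_free a f) i j
  = \sum_(w <- msupp f) f@_w * entry (word_value a w) i j.
Proof.
rewrite /eval_free mmapE.
rewrite (big_morph (fun z => entry z i j) (fun y z => entryD y z i j)
  (entry0 _ i j)) /=.
by apply/eq_bigr=> w _; rewrite -scalerAl mul1r entryZ.
Qed.

Lemma entry_word_value_cons a x w i l :
  entry (word_value a (x :: w)) i l
  = \sum_(k < l.+1) UTcoef (a x) i k * entry (word_value a w) k l.
Proof. by rewrite /word_value big_cons entry_to_unitizationM. Qed.

Lemma UTcompP g (u : UT F) :
  UTcomp F eps g u <->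
  forall i j, (i <= j)%N -> UTcoef u i j != 0 -> UTdeg eps i j = g.
Proof.
split=> [ug i j ij|ug p].
  pose p : UTidx := Sub (i, j) ij.
  by rewrite (UTcoef_val u p) mcoeff_neq0; apply: (ug p).
by rewrite -mcoeff_neq0 -UTcoef_val; apply: ug; apply: valP p.
Qed.

Lemma UTdegii i : UTdeg eps i i = 1%g.
Proof. by rewrite /UTdeg big_geq. Qed.

Lemma UTdegM i j k : (i <= j)%N -> (j <= k)%N ->
  (UTdeg eps i j * UTdeg eps j k)%g = UTdeg eps i k.
Proof. by move=> ij jk; rewrite /UTdeg -big_cat_nat. Qed.

(** * Paths through full rows *)

(** The path is built from its end: a step e_ij is put in front of the path
found for the rest of the word, which starts in row j.  The assignment of the
rest is zero above row j, so the new edge is the only one leaving row i.  The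
conclusion is claimed for every b agreeing with a from row i on because the
induction needs it for an assignment extended by an edge above row i. *)
Lemma separating_assignment :
    (forall i, SuppR eps i = [set: G]%classic) ->
  forall w i, exists a l,
    [/\ graded_assignment a, (i <= l)%N,
        forall x r m, (r < i)%N -> UTcoef (a x) r m = 0
      & forall b,
          (forall x r m, (i <= r)%N -> UTcoef (b x) r m = UTcoef (a x) r m) ->
        forall v, entry (word_value b v) i l = (v == w)%:R].
Proof.
move=> full; elim=> [|x w IH] i.
  exists (fun=> 0), i; split=> // [g n|x r m _|b bE v].
  - by apply/UTcompP=> r m _; rewrite UTcoef0 eqxx.
  - exact: UTcoef0.
  case: v => [|y v]; first by rewrite /word_value big_nil entry1 eqxx.
  rewrite entry_word_value_cons big1 // => k _.
  by rewrite bE // UTcoef0 mul0r.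
have [j /= ij jx] : SuppR eps i x.1 by rewrite full.
have {IH} [a [l [a_gr jl a_low aE]]] := IH j.
pose a' y := a y + (y == x)%:R *: UTe F i j.
have a'E y r m : UTcoef (a' y) r m
    = UTcoef (a y) r m + ((y == x) && (i == r) && (j == m))%:R.
  by rewrite UTcoefD UTcoefZ UTcoefe ?(ltnW ij) // -natrM mulnb andbA.
exists a', l; split.
- move=> g n; apply/UTcompP=> r m rm; rewrite a'E.
  case: andP => [[/andP[/eqP yx /eqP <-] /eqP <-] _|_].
    by rewrite jx -yx.
  by rewrite addr0; move/UTcompP: (a_gr g n); apply.
- by rewrite (leq_trans (ltnW ij) jl).
- move=> y r m ri; rewrite a'E a_low ?(ltn_trans ri ij) // add0r.
  by rewrite (gtn_eqF ri) andbF.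
move=> b bE [|y v].
  by rewrite /word_value big_nil entry1 (ltn_eqF (leq_trans ij jl)).
rewrite entry_word_value_cons.
(* Row [i] of every [b y] is zero except for the new entry at [x]. *)
under eq_bigr => k _ do rewrite bE // a'E a_low // add0r eqxx andbT.
have jl' : (j < l.+1)%N by [].
rewrite (bigD1 (Ordinal jl')) //= eqxx andbT big1 ?addr0; last first.
  move=> k kj; case: (eqVneq j k) => [jk|_]; last by rewrite andbF mul0r.
  by case/eqP: kj; apply: val_inj.
(* Below row [i] the new entry is invisible, so the induction hypothesis
   applies to the rest of the word. *)
rewrite aE => [|z r m jr]; last first.
  rewrite bE ?a'E ?(leq_trans (ltnW ij)) //.
  by rewrite (ltn_eqF (leq_trans ij jr)) andbF addr0.
by rewrite -natrM mulnb -eqseq_cons.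
Qed.

(** Supp R_i contains the translate of Supp R_k by deg e_ik. *)
Lemma SuppR_le i k : (i <= k)%N ->
  SuppR eps k = [set: G]%classic -> SuppR eps i = [set: G]%classic.
Proof.
move=> ik full; apply/seteqP; split=> // g _.
have [j /= kj jE] : SuppR eps k ((UTdeg eps i k)^-1 * g)%g by rewrite full.
exists j; first exact: leq_ltn_trans ik kj.
by rewrite -(UTdegM ik (ltnW kj)) jE mulKVg.
Qed.

Lemma graded_identities_full :
    (forall i, SuppR eps i = [set: G]%classic) ->
  graded_identities F eps = [set 0]%classic.
Proof.
move=> full; apply/seteqP; split=> [f fid|_ -> a _]; last first.
  by rewrite /eval_free mmapE msupp0 big_seq_fset0.
apply/malgP=> w; rewrite mcoeff0.
have [a [l [a_gr _ _ aE]]] := separating_assignment full w 0.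
have := entry_eval_free a f 0 l; rewrite (fid a a_gr) entry0.
under eq_bigr => v _ do rewrite (aE a) //.
case: (msuppP f w) => [wf|wf _]; last by [].
rewrite (bigD1_seq w) //= ?fset_uniq // eqxx mulr1 big1 ?addr0 // => v vw.
by rewrite (negPf vw) mulr0.
Qed.

(** * A monomial without paths *)

(** Each step of the path is strict: a homogeneous element of degree other
than 1 has zero diagonal because e_ii has degree 1. *)
Lemma word_value_path a (u v : word (G * nat)%type) i l :
    graded_assignment a -> all (fun x => x.1 != 1%g) u ->
    entry (word_value a (u ++ v)) i l != 0 ->
  exists j, [/\ (i + size u <= j)%N, UTdeg eps i j = (\prod_(x <- u) x.1)%g
    & entry (word_value a v) j l != 0].
Proof.
move=> a_gr; elim: u i => [|x u IH] i /=.
  by move=> _ nz; exists i; rewrite addn0 UTdegii big_nil.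
case/andP=> x1 u1; rewrite entry_word_value_cons => nz.
have [k] : exists k : 'I_l.+1,
    UTcoef (a x) i k * entry (word_value a (u ++ v)) k l != 0.
  apply/existsP; apply: contraNT nz.
  rewrite negb_exists => /forallP zero; rewrite big1 // => k _.
  exact/eqP/negbNE/zero.
rewrite mulf_eq0 negb_or => /andP[ik_nz /(IH _ u1) [j [kj jE nzj]]].
have ik : (i <= k)%N by rewrite leqNgt; apply: contraNN ik_nz => ki; rewrite UTcoef_lt.
have degE : UTdeg eps i k = x.1.
  by case: x {x1 nz} ik_nz => g n ik_nz; move/UTcompP: (a_gr g n); apply.
have ltik : (i < k)%N.
  rewrite ltn_neqAle ik andbT; apply: contraNneq x1 => ikE.
  by rewrite -degE -ikE UTdegii.
exists j; split=> //; first by rewrite addnS -addSn (leq_trans _ kj) ?leq_add2r.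
by rewrite big_cons -degE -jE UTdegM // (leq_trans _ kj) ?leq_addr.
Qed.

(** The targets are reached one after the other: if s has degree p, appending
a letter of degree p^-1 g reaches g, unless p = g already; then the detour
h, h^-1 returns to g.  The detour also covers the empty s, whose degree 1 is
not that of a nonempty prefix. *)
Lemma covering_word (h : G) (t : seq G) : h != 1%g ->
  exists s : word (G * nat)%type, all (fun x => x.1 != 1%g) s
    /\ forall g, g \in t -> exists u v,
         [/\ s = u ++ v, u != [::] & (\prod_(x <- u) x.1)%g = g].
Proof.
move=> h1; elim: t => [|g t [s [s1 sP]]]; first by exists [::].
pose p := (\prod_(x <- s) x.1)%g.
pose e : word (G * nat)%type :=
  if p == g then [:: (h, 0); (h^-1%g, 0)] else [:: ((p^-1 * g)%g, 0)].
exists (s ++ e); split.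
  rewrite all_cat s1 /e; case: eqVneq => /= [_|pg]; first by rewrite invg_eq1 h1.
  by rewrite andbT -eq_mulVg1.
move=> k; rewrite inE => /predU1P[->|kt]; last first.
  by have [u [v [-> u0 uk]]] := sP k kt; exists u, (v ++ e); rewrite catA.
exists (s ++ e), [::]; split; first by rewrite cats0.
  by rewrite /e; case: ifP; case: (s).
rewrite big_cat -/p /= /e; case: eqVneq => [<-|_].
  by rewrite !big_cons big_nil /= mulg1 mulgV mulg1.
by rewrite big_seq1 /= mulKVg.
Qed.

Lemma monomial_identity : eventually_incomplete eps ->
  exists w, graded_identities F eps << w >>.
Proof.
case=> N incomplete.
have [h h1] : exists h : G, h != 1%g.
  apply: contra_notP (incomplete N (leqnn N)) => trivG.
  have G1 (g : G) : g = 1%g.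
    by apply: contra_notP trivG => g1; exists g; apply/eqP.
  by apply/seteqP; split=> // g _; exists N.+1; rewrite //= [LHS]G1 [RHS]G1.
have [s [s1 sP]] := covering_word (enum G) h1.
(* The leading block pushes every path beyond row N. *)
pose w := nseq N.+1 (h, 0) ++ s.
exists w => a a_gr.
have valE : eval_free a << w >> = word_value a w.
  by rewrite /eval_free mmapE msuppU1 big_seq_fset1 mcoeffUU scale1r mul1r.
have entry_w i l : entry (word_value a w) i l = 0.
  apply: contrapT => /eqP nz.
  have h1s : all (fun x => x.1 != 1%g) (nseq N.+1 (h, 0)).
    by rewrite all_nseq h1 orbT.
  have [k [ik _ nzk]] := word_value_path a_gr h1s nz.
  have Nk : (N <= k)%N by move: ik; rewrite size_nseq; lia.
  apply: (incomplete k Nk); apply/seteqP; split=> // g _.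
  have [|u [v [sE u0 <-]]] := sP g; first by rewrite mem_enum.
  rewrite sE in s1 nzk; move: s1; rewrite all_cat => /andP[u1 _].
  have [j [kj <- _]] := word_value_path a_gr u1 nzk.
  by exists j => //=; case: (u) u0 kj => //= x u' _; lia.
have val1 : (word_value a w).1 = 0.
  by rewrite /word_value big_cons /= mul0r.
rewrite valE; case: (word_value a w) val1 entry_w => z1 z2 /= -> zE.
congr (_, _); apply/malgP=> p; rewrite mcoeff0 -UTcoef_val.
by have := zE (val p).1 (val p).2; rewrite /entry /= mul0rn add0r.
Qed.

End GradedEvaluation.

Theorem theorem4p18 (F : fieldType) (G : finGroupType) (eps : nat -> G) :
  eventually_incomplete eps <-> graded_identities F eps <> [set 0]%classic.
Proof.
split=> [inc|ids_nz].
  have [w w_id] := monomial_identity F inc; move=> ids0.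
  move: w_id; rewrite ids0 /= => /malgP/(_ w)/eqP.
  by rewrite mcoeffUU mcoeff0 oner_eq0.
apply: contrapT => compl; apply: ids_nz; apply: graded_identities_full => i.
apply: contrapT => not_full; apply: compl; exists i => k ik.
exact: contra_not (SuppR_le ik) not_full.
Qed.
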